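(* Let $A$ and $B$ be commutative $C^*$-algebras, let $E$ be a Hilbert $C^*$-module over $A$ and $F$ a Hilbert $C^*$-module over $B$, and let $T:E\to F$ be a surjective linear isometry. Then $T$ preserves the inner products and is a module map; that is, there exists a $*$-isomorphism $\varphi:A\to B$ such that $$\langle Tx,Ty\rangle=\varphi(\langle x,y\rangle)\quad\text{and}\quad T(xa)=T(x)\varphi(a)$$ for all $x,y\in E$ and all $a\in A$.
   Context: A (right) Hilbert $C^*$-module over a $C^*$-algebra $A$ is a right $A$-module $E$ (a complex vector space with compatible action) equipped with an $A$-valued (positive definite) inner product $\langle\cdot,\cdot\rangle$ which is conjugate $A$-linear in the first variable (so $\langle xa,y\rangle=a^*\langle x,y\rangle$) and $A$-linear in the second variable ($\langle x,ya\rangle=\langle x,y\rangle a$), such that $E$ is a Banach space with respect to the norm $\|x\|=\|\langle x,x\rangle\|^{1/2}$. Isometry means isometry for these norms.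
   Formalization: E and F are additionally assumed full (the inner products span a dense subspace of A, resp. B); without this the claim fails, e.g. E=F=C, A=C, B=C² with ⟨x,y⟩=(x̄y,0) and T=id, where A and B are not *-isomorphic. *)

(* Defs.v *)
From HB Require Import structures.
From mathcomp Require Import all_boot all_order all_algebra.
From mathcomp Require Import all_classical all_reals all_analysis.
From mathcomp Require Import complex.

Set Implicit Arguments.
Unset Strict Implicit.
Unset Printing Implicit Defensive.

Import Order.TTheory GRing.Theory Num.Theory.
Import numFieldNormedType.Exports.

Local Open Scope classical_set_scope.
Local Open Scope ring_scope.
Local Open Scope complex_scope.

Declare Scope cstar_scope.
Delimit Scope cstar_scope with cstar.

(* The complex numbers are R[i]. No unit is assumed, so the product cannot be
   the one of a MathComp ring. Norms on a normed module over R[i] take their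
   (nonnegative real) values in R[i]. *)
HB.mixin Record isCStarAlgebra (R : realType) A
    of CompleteNormedModule R[i] A := {
  cmul : A -> A -> A;
  cstar : A -> A;
  cmulA : associative cmul;
  cmulDl : left_distributive cmul +%R;
  cmulDr : right_distributive cmul +%R;
  cmulZl : forall (k : R[i]) (a b : A), cmul (k *: a) b = k *: cmul a b;
  cmulZr : forall (k : R[i]) (a b : A), cmul a (k *: b) = k *: cmul a b;
  cstarK : involutive cstar;
  cstarD : {morph cstar : a b / a + b};
  cstarZ : forall (k : R[i]) (a : A), cstar (k *: a) = k^* *: cstar a;
  cstarM : forall a b : A, cstar (cmul a b) = cmul (cstar b) (cstar a);
  cnormM : forall a b : A, `|cmul a b| <= `|a| * `|b|;
  cnorm_star : forall a : A, `|cmul (cstar a) a| = `|a| ^+ 2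
}.

#[short(type="cstarAlgType")]
HB.structure Definition CStarAlgebra (R : realType) :=
  {A of isCStarAlgebra R A & CompleteNormedModule R[i] A}.

Notation "a ** b" := (cmul a b) (at level 40, left associativity)
  : cstar_scope.
Notation "a ^*" := (cstar a) : cstar_scope.
Local Open Scope cstar_scope.

(* Positivity in the form a = b^* b, which refers to neither a unit nor a
   spectrum. *)
Definition cstar_ge0 (R : realType) (A : cstarAlgType R) (a : A) : Prop :=
  exists b : A, a = b^* ** b.

(* [act x a] is the right action x a and [ip x y] is the A-valued inner
   product <x, y>. The carrier is a Banach space whose norm is the one given
   by the inner product, by hnormE. *)
HB.mixin Record isHilbertModule (R : realType) (A : cstarAlgType R) E
    of CompleteNormedModule R[i] E := {
  act : E -> A -> E;
  ip : E -> E -> A;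
  actDl : forall (x y : E) (a : A), act (x + y) a = act x a + act y a;
  actDr : forall (x : E) (a b : A), act x (a + b) = act x a + act x b;
  actZl : forall (k : R[i]) (x : E) (a : A), act (k *: x) a = k *: act x a;
  actZr : forall (k : R[i]) (x : E) (a : A), act x (k *: a) = k *: act x a;
  actA : forall (x : E) (a b : A), act x (a ** b) = act (act x a) b;
  ipDl : forall x y z : E, ip (x + y) z = ip x z + ip y z;
  ipDr : forall x y z : E, ip x (y + z) = ip x y + ip x z;
  ipZl : forall (k : R[i]) (x y : E), ip (k *: x) y = (k^*)%C *: ip x y;
  ipZr : forall (k : R[i]) (x y : E), ip x (k *: y) = k *: ip x y;
  ip_actl : forall (x y : E) (a : A), ip (act x a) y = a^* ** ip x y;
  ip_actr : forall (x y : E) (a : A), ip x (act y a) = ip x y ** a;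
  ip_star : forall x y : E, (ip x y)^* = ip y x;
  ip_ge0 : forall x : E, cstar_ge0 (ip x x);
  ip_eq0 : forall x : E, ip x x = 0 -> x = 0;
  hnormE : forall x : E, `|x| = sqrtC `|ip x x|
}.

#[short(type="hilbertModType")]
HB.structure Definition HilbertModule (R : realType) (A : cstarAlgType R) :=
  {E of isHilbertModule R A E & CompleteNormedModule R[i] E}.

(* The set under the closure is the linear span of the inner products: scalars
   are absorbed by ip. Fullness is what makes phi defined on all of A and onto
   B: for E = F = 0 the inner products say nothing about A and B. *)
Definition full_module (R : realType) (A : cstarAlgType R)
    (E : hilbertModType A) : Prop :=
  closure [set a : A | exists (n : nat) (x y : 'I_n -> E),
                         a = \sum_(i < n) ip (x i) (y i)] = [set: A].

Definition star_isomorphism (R : realType) (A B : cstarAlgType R)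
    (phi : {linear A -> B}) : Prop :=
  [/\ bijective phi,
      {morph phi : a b / a ** b}
    & {morph phi : a / a^*}].

(* Main.v *)
(* A Hilbert module over a commutative C*-algebra is a field of Hilbert spaces
   over the characters: |x|^2 is the maximum of chi <x, x>.
   - Enough characters exist because a minimal C*-seminorm p with p b = |b| > 0
     is multiplicative on self-adjoint elements, and then its kernel has
     codimension one: if p a = p b = 1 then p (a^(2^k) - b^(2^k)) doubles with
     every k >= 1 although it stays below 2, so p (a - b) p (a + b) = 0.
   - Testing T on vectors peaking at a character chi of B, and using that the
     squared norm of y + x a at psi is the one of y + psi(a) x, shows that
     x |-> T (x a) acts on the fibre at chi as a scalar g a, and that g is a
     character of A.
   - Peaking vectors also give chi <Tx, Tx> <= g <x, x>, and the inverse of T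
     gives the converse; by polarization chi <Tx, Ty> = g <x, y>.
   So T relates the characters of A and B, hence the closed spans of the inner
   products, which are A and B by fullness. *)
Require Import Defs.
From HB Require Import structures.
From mathcomp Require Import all_boot all_order all_algebra.
From mathcomp Require Import all_classical all_reals all_analysis.
From mathcomp Require Import complex ring lra.

Set Implicit Arguments.
Unset Strict Implicit.
Unset Printing Implicit Defensive.

Import Order.TTheory GRing.Theory Num.Theory.
Import numFieldNormedType.Exports.

Local Open Scope classical_set_scope.
Local Open Scope ring_scope.
Local Open Scope cstar_scope.
Local Open Scope complex_scope.

Local Notation Re := complex.Re.
Local Notation Im := complex.Im.

(** * Real-valued norms and C*-seminorms *)

(** Norms here are valued in [R[i]]; the real part makes them available to real order reasoning and
    [lra]. *)
Definition nrm (R : realType) (V : normedZmodType R[i]) (v : V) : R := Re `|v|.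

Section RealNorm.
Variable R : realType.

Lemma conjCE (k : R[i]) : Num.conj k = k^*%C.
Proof.
have [->|k0] := eqVneq k 0; first by rewrite !rmorph0.
by apply: (mulfI k0); rewrite -normCK sqr_normc.
Qed.

Lemma nrmE (V : normedZmodType R[i]) (v : V) : `|v| = (nrm v)%:C.
Proof. by rewrite /nrm RRe_real// normr_real. Qed.

Lemma nrm_ge0 (V : normedZmodType R[i]) (v : V) : 0 <= nrm v.
Proof. by rewrite -ler0c -nrmE. Qed.

Lemma nrmD (V : normedZmodType R[i]) (v w : V) : nrm (v + w) <= nrm v + nrm w.
Proof. by rewrite -lecR rmorphD/= -!nrmE ler_normD. Qed.

Lemma nrmN (V : normedZmodType R[i]) (v : V) : nrm (- v) = nrm v.
Proof. by rewrite /nrm normrN. Qed.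

Lemma nrm0 (V : normedZmodType R[i]) : nrm (0 : V) = 0.
Proof. by rewrite /nrm normr0. Qed.

Lemma nrm_eq0 (V : normedZmodType R[i]) (v : V) : nrm v = 0 -> v = 0.
Proof. by move=> v0; apply/eqP; rewrite -normr_eq0 nrmE v0. Qed.

Lemma nrmM (k l : R[i]) : nrm (k * l) = nrm k * nrm l.
Proof. by apply: complexI; rewrite rmorphM/= -!nrmE normrM. Qed.

Lemma nrmZ (V : normedModType R[i]) (k : R[i]) (v : V) :
  nrm (k *: v) = nrm k * nrm v.
Proof. by apply: complexI; rewrite rmorphM/= -!nrmE normrZ. Qed.

Lemma nrm_sqr (k : R[i]) : nrm k ^+ 2 = Re k ^+ 2 + Im k ^+ 2.
Proof. by apply: complexI; rewrite add_Re2_Im2 nrmE rmorphXn. Qed.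

Lemma nrm_real (r : R) : nrm r%:C = `|r|.
Proof.
apply/eqP; rewrite -(eqrXn2 (n := 2))// ?nrm_ge0//.
by rewrite nrm_sqr expr0n addr0 real_normK ?num_real.
Qed.

Lemma nrm_i : nrm ('i : R[i]) = 1.
Proof.
apply/eqP; rewrite -(eqrXn2 (n := 2))// ?nrm_ge0//.
by rewrite nrm_sqr expr0n add0r expr1n.
Qed.

Lemma Re_le_nrm (k : R[i]) : Re k <= nrm k.
Proof.
apply: le_trans (ler_norm _) _.
by rewrite -lecR -nrmE normc_ge_Re.
Qed.

End RealNorm.

Section CStarBasics.
Variables (R : realType) (A : cstarAlgType R).
Implicit Types a b : A.

Lemma cmulNl a b : (- a) ** b = - (a ** b).
Proof. by rewrite -scaleN1r cmulZl scaleN1r. Qed.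

Lemma cmulNr a b : a ** (- b) = - (a ** b).
Proof. by rewrite -scaleN1r cmulZr scaleN1r. Qed.

Lemma cmulBl a b c : (a - b) ** c = a ** c - b ** c.
Proof. by rewrite cmulDl cmulNl. Qed.

Lemma cmulBr a b c : a ** (b - c) = a ** b - a ** c.
Proof. by rewrite cmulDr cmulNr. Qed.

Lemma cstarZc (k : R[i]) a : cstar (k *: a) = k^*%C *: cstar a.
Proof. by rewrite cstarZ conjCE. Qed.

Lemma cstarN a : cstar (- a) = - cstar a.
Proof. by rewrite -scaleN1r cstarZc rmorphN rmorph1 scaleN1r. Qed.

Lemma cstarB a b : cstar (a - b) = cstar a - cstar b.
Proof. by rewrite cstarD cstarN. Qed.

Lemma nrm_cmul a b : nrm (a ** b) <= nrm a * nrm b.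
Proof. by rewrite -lecR rmorphM/= -!nrmE cnormM. Qed.

Lemma nrm_star a : nrm (cstar a ** a) = nrm a ^+ 2.
Proof. by apply: complexI; rewrite rmorphXn/= -!nrmE cnorm_star. Qed.

(** The C*-condition is only an inequality because this form passes to infima; equality,
    nonnegativity and invariance under the star follow from the fields. *)
Record cseminorm (p : A -> R) : Prop := CSeminorm {
  csD : forall a b, p (a + b) <= p a + p b;
  csZ : forall k a, p (k *: a) = nrm k * p a;
  csM : forall a b, p (a ** b) <= p a * p b;
  csS : forall a, p a ^+ 2 <= p (cstar a ** a);
  cs_le : forall a, p a <= nrm a }.

Lemma cseminorm_nrm : cseminorm (@nrm R A).
Proof.
split=> // [a b|k a|a b|a].
- exact: nrmD.
- exact: nrmZ.
- exact: nrm_cmul.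
- by rewrite nrm_star.
Qed.

Section CSeminormTheory.
Variables (p : A -> R) (cp : cseminorm p).

Lemma cs0 : p 0 = 0.
Proof. by have := csZ cp 0 0; rewrite scale0r nrm0 mul0r. Qed.

Lemma csN a : p (- a) = p a.
Proof.
rewrite -scaleN1r (csZ cp) nrmN -(rmorph1 (real_complex R)) nrm_real.
by rewrite normr1 mul1r.
Qed.

Lemma cs_ge0 a : 0 <= p a.
Proof. by have := csD cp a (- a); rewrite subrr cs0 csN; lra. Qed.

Lemma csB a b : p (a - b) <= p a + p b.
Proof. by apply: le_trans (csD cp _ _) _; rewrite csN. Qed.

(** Dividing [p b ^+ 2 <= p (cstar b ** b) <= p (cstar b) * p b] by [p b] gives one inequality, and
    the involution gives the other. *)
Lemma cs_star a : p (cstar a) = p a.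
Proof.
have H b : p b <= p (cstar b).
  have [|pb] := leP (p b) 0; first by move=> /le_trans; apply; exact: cs_ge0.
  rewrite -(ler_pM2r pb) -expr2; exact: le_trans (csS cp _) (csM cp _ _).
by apply/eqP; rewrite eq_le H andbT -{2}(cstarK a) H.
Qed.

Lemma csSE a : p (cstar a ** a) = p a ^+ 2.
Proof.
apply/eqP; rewrite eq_le (csS cp) andbT expr2.
by apply: le_trans (csM cp _ _) _; rewrite cs_star.
Qed.

Lemma cs_sqr a : cstar a = a -> p (a ** a) = p a ^+ 2.
Proof. by move=> ha; rewrite -csSE ha. Qed.

End CSeminormTheory.

(** Directedness provides one index for two summands or factors. Products and the C*-condition may
    move to another index, as needed for the sequence p(c^n a), where a product doubles the
    exponent. *)
Lemma cseminorm_inf (I : Type) (i0 : I) (p : I -> A -> R) :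
  (forall i j, exists k, forall a, p k a <= p i a /\ p k a <= p j a) ->
  (forall i a b, p i (a + b) <= p i a + p i b) ->
  (forall i k a, p i (k *: a) = nrm k * p i a) ->
  (forall i, exists j, forall a b, p j (a ** b) <= p i a * p i b) ->
  (forall i, exists j, forall a, p j a ^+ 2 <= p i (cstar a ** a)) ->
  (forall i a, p i a <= nrm a) ->
  cseminorm (fun a => inf (range (fun i => p i a))).
Proof.
move=> dir pD pZ pM pS ple.
have p0 i : p i 0 = 0 by have := pZ i 0 0; rewrite scale0r nrm0 mul0r.
have p_ge0 i a : 0 <= p i a.
  have := pD i a (-1 *: a); rewrite pZ scaleN1r subrr p0 nrmN.
  by rewrite -(rmorph1 (real_complex R)) nrm_real normr1 mul1r; lra.
set q := fun a => _.
have qle i a : q a <= p i a.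
  apply: ge_inf; last by exists i.
  by exists 0 => _ [j _ <-].
have qge a c : (forall i, c <= p i a) -> c <= q a.
  move=> H; apply: lb_le_inf; first by exists (p i0 a); exists i0.
  by move=> _ [j _ <-].
have q_ge0 a : 0 <= q a by apply: qge.
have qgeM a c d : 0 <= c -> (forall i, d <= p i a * c) -> d <= q a * c.
  rewrite le_eqVlt => /predU1P[<- /(_ i0)|c0 H]; first by rewrite !mulr0.
  by rewrite -ler_pdivrMr//; apply: qge => i; rewrite ler_pdivrMr.
split.
- move=> a b.
  suff : forall i, q (a + b) - p i a <= q b.
    move=> H; rewrite -lerBlDr; apply: qge => i.
    by have := H i; lra.
  move=> i; apply: qge => j; have [k Hk] := dir i j.
  have := Hk a; have := Hk b; have := pD k a b; have := qle k (a + b).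
  lra.
- move=> k a; apply/eqP; rewrite eq_le; apply/andP; split.
    by rewrite mulrC; apply: qgeM; [exact: nrm_ge0|move=> i; rewrite mulrC -pZ].
  by apply: qge => i; rewrite pZ ler_wpM2l ?nrm_ge0.
- move=> a b; apply: (qgeM) => // i; rewrite mulrC.
  apply: qgeM => // j; rewrite mulrC.
  have [k Hk] := dir i j; have [l Hl] := pM k.
  apply: le_trans (qle l _) _; apply: le_trans (Hl _ _) _.
  by apply: ler_pM => //; [have [] := Hk a|have [] := Hk b].
- move=> a; apply: qge => i; have [j Hj] := pS i.
  by apply: le_trans (Hj a); rewrite ler_sqr ?nnegrE.
- by move=> a; apply: le_trans (qle i0 _) _.
Qed.

(** Zorn's lemma applies because the pointwise infimum of a chain is again a C*-seminorm with value
    [r] at [b]. *)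
Lemma cseminorm_min (b : A) (r : R) : nrm b = r ->
  exists p, [/\ cseminorm p, p b = r &
    forall q, cseminorm q -> q b = r -> (forall a, q a <= p a) -> q = p].
Proof.
move=> br.
pose P (p : A -> R) := cseminorm p /\ p b = r.
pose T := {p : A -> R | P p}.
(* The order is reversed, so that a maximal element is a minimal seminorm. *)
have [||||[p [cp pb]] pmin] :=
    @Zorn T (fun p q => `[< forall a, sval q a <= sval p a >]).
- by move=> t; apply/asboolP.
- move=> s t u /asboolP H1 /asboolP H2; apply/asboolP => a.
  exact: le_trans (H2 a) (H1 a).
- move=> [f Pf] [g Pg] /asboolP/= H1 /asboolP/= H2.
  have fg : f = g by apply/funext => a; apply/eqP; rewrite eq_le H1 H2.
  by case: g / fg Pg {H1 H2} => Pg; congr exist; exact: Prop_irrelevance.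
- move=> C totC.
  have [[p0 Cp0]|C0] := pselect (exists p, C p); last first.
    (* The empty chain is bounded by the norm itself. *)
    exists (exist P _ (conj cseminorm_nrm br)) => s Cs.
    by case: C0; exists s.
  pose I := {p : T | C p}.
  pose i0 : I := exist _ p0 Cp0.
  pose f (i : I) : A -> R := sval (sval i).
  have cf i : cseminorm (f i) by case: (svalP (sval i)).
  have cq : cseminorm (fun a => inf (range (fun i => f i a))).
    apply: (cseminorm_inf i0).
    + move=> i j; case: (totC _ _ (svalP i) (svalP j)) => /asboolP H.
        by exists j => a; split=> //; exact: H.
      by exists i => a; split=> //; exact: H.
    + by move=> i; exact: csD.
    + by move=> i; exact: csZ.
    + by move=> i; exists i; exact: csM.
    + by move=> i; exists i; exact: csS.
    + by move=> i; exact: cs_le.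
  have qb : inf (range (fun i => f i b)) = r.
    have -> : range (fun i => f i b) = [set r]%classic.
      apply/seteqP; split => [_ [i _ <-]|_ ->] /=.
        by case: (svalP (sval i)).
      by exists i0 => //; case: (svalP (sval i0)).
    exact: inf1.
  exists (exist P _ (conj cq qb)) => s Cs; apply/asboolP => a /=.
  apply: ge_inf; last by exists (exist _ s Cs).
  by exists 0 => _ [j _ <-]; apply: cs_ge0.
- exists p; split=> // q cq qb qp.
  have := pmin (exist P q (conj cq qb)).
  by move=> H; have := H (introT (asboolP _) qp); case.
Qed.

End CStarBasics.

(** * Characters *)

Section Gelfand.
Variables (R : realType) (A : cstarAlgType R).
Hypothesis commA : commutative (@cmul R A).
Implicit Types a b c : A.

(** * Minimal C*-seminorms are multiplicative on self-adjoint elements *)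

Section IterMul.
Variable p : A -> R.
Hypothesis cp : cseminorm p.
Variable c : A.
Hypotheses (csa : cstar c = c) (pc : p c = 1).

(** This is multiplication by c^n, kept as an operator because c^0 would be a unit. *)
Let pw n := iter n (cmul c).

Let pwMl n a b : pw n a ** b = pw n (a ** b).
Proof. by elim: n => //= n <-; rewrite cmulA. Qed.

Let pwM m n a b : pw (m + n) (a ** b) = pw m a ** pw n b.
Proof.
by rewrite pwMl [a ** pw n b]commA pwMl commA [b ** a]commA /pw -iterD.
Qed.

Let pwD n a b : pw n (a + b) = pw n a + pw n b.
Proof. by elim: n => //= n ->; rewrite cmulDr. Qed.

Let pwZ n k a : pw n (k *: a) = k *: pw n a.
Proof. by elim: n => //= n ->; rewrite cmulZr. Qed.

Let pwS n a : cstar (pw n a) = pw n (cstar a).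
Proof. by elim: n => //= n <-; rewrite cstarM csa commA. Qed.

Let pw_le n a : p (pw n a) <= p a.
Proof.
elim: n => //= n; apply: le_trans.
by apply: le_trans (csM cp _ _) _; rewrite pc mul1r.
Qed.

(* Minimality of [p] will force this limit of [p (c^n a)] to be [p]; at [n = 1]
   this is multiplicativity. *)
Lemma cseminorm_pw : cseminorm (fun a => inf (range (fun n => p (pw n a)))).
Proof.
apply: (@cseminorm_inf _ _ nat 0%N).
- move=> i j; exists (i + j)%N => a; split.
    by rewrite addnC /pw iterD pw_le.
  by rewrite /pw iterD pw_le.
- by move=> i a b; rewrite pwD (csD cp).
- by move=> i k a; rewrite pwZ (csZ cp).
- by move=> i; exists (i + i)%N => a b; rewrite pwM (csM cp).
- move=> i; exists i => a; rewrite -(csSE cp) pwS -pwM /pw iterD.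
  exact: pw_le.
- by move=> i a; apply: le_trans (pw_le _ _) (cs_le cp _).
Qed.

Lemma inf_pw_le n a : inf (range (fun n => p (pw n a))) <= p (pw n a).
Proof.
by apply: ge_inf; [exists 0 => _ [j _ <-]; apply: cs_ge0|exists n].
Qed.

(** [pw n c] is c^(n+1). Its square has value 1 by the C*-identity and equals c^n c^(n+2), so
    p(c^(n+2)) is at least 1. *)
Lemma cs_pw1 n : p (pw n c) = 1.
Proof.
elim: n => //= n IH; apply/eqP; rewrite eq_le; apply/andP; split.
  by apply: le_trans (csM cp _ _) _; rewrite pc IH mul1r.
have := pw_le n (pw n.+1 c); rewrite {1}/pw -iterD.
suff -> : iter (n + n.+1) (cmul c) c = pw n c ** pw n c.
  by rewrite (cs_sqr cp) ?pwS ?csa// IH expr1n.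
by rewrite pwMl iterD.
Qed.

End IterMul.

Section Minimal.
Variables (p : A -> R) (b : A).
Hypotheses (cp : cseminorm p) (bsa : cstar b = b) (pb : p b = 1).
Hypothesis pmin :
  forall q, cseminorm q -> q b = 1 -> (forall a, q a <= p a) -> q = p.

(** The infimum over n keeps the value 1 at [b], so minimality identifies it with [p]; its term at n
    = 1 then gives p(a) <= p(c a). *)
Let pwb1 c (csa : cstar c = c) (pc : p c = 1) :
  (forall n, p (iter n (cmul c) b) = 1) -> forall a, p (c ** a) = p a.
Proof.
move=> H a; apply/eqP; rewrite eq_le; apply/andP; split.
  by apply: le_trans (csM cp _ _) _; rewrite pc mul1r.
have := pmin (cseminorm_pw cp csa pc) _ _.
move=> /(_ _ _)/(congr1 (fun f => f a)) <-; first exact: (inf_pw_le cp c 1).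
  have -> : range (fun n => p (iter n (cmul c) b)) = [set 1%R]%classic.
    apply/seteqP; split => [_ [i _ <-]|_ ->] /=; first exact: H.
    by exists 0%N.
  exact: inf1.
by move=> x; apply: (inf_pw_le cp c 0).
Qed.

Lemma min_csM c a : cstar c = c -> p (c ** a) = p c * p a.
Proof.
move=> csa; have [pc0|pc0] := eqVneq (p c) 0.
  apply/eqP; rewrite eq_le pc0 mul0r (cs_ge0 cp) andbT.
  by apply: le_trans (csM cp _ _) _; rewrite pc0 mul0r.
have pcgt : 0 < p c by rewrite lt_neqAle eq_sym pc0 cs_ge0.
(* The case c = b comes first: it removes [b] from b d^(n+1), leaving a power of [d], whose value is
   1. *)
have bM x : p (b ** x) = p x by apply: pwb1 => // n; exact: cs_pw1.
pose d := ((p c)^-1)%:C *: c.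
have dsa : cstar d = d by rewrite cstarZc conjc_real csa.
have nV : nrm ((p c)^-1)%:C = (p c)^-1.
  by rewrite nrm_real gtr0_norm ?invr_gt0.
have pd : p d = 1 by rewrite (csZ cp) nV mulVf.
have := pwb1 dsa pd _ a; rewrite cmulZl (csZ cp) nV => <-.
  by rewrite mulrA divff ?mul1r.
case=> //= n; rewrite -(cs_pw1 cp dsa pd n) -[RHS]bM.
suff -> : d ** iter n (cmul d) b = b ** iter n (cmul d) d by [].
rewrite -!iterS; elim: n => [|n IH]; first by rewrite /= commA.
by rewrite iterS IH !cmulA [d ** b]commA.
Qed.

End Minimal.

(** * Characters from multiplicative seminorms *)

Lemma cmulACA a b c d : (a ** b) ** (c ** d) = (a ** c) ** (b ** d).
Proof. by rewrite -!cmulA [b ** (c ** d)]cmulA [b ** c]commA !cmulA. Qed.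

Lemma csub_sqr a b : (a - b) ** (a + b) = a ** a - b ** b.
Proof. by rewrite cmulBl !cmulDr [b ** a]commA opprD addrA addrK. Qed.

(** With z = a + i b, commutativity gives [cstar z ** z] = a^2 + b^2, while 2a = z + [cstar z] gives
    p(a) <= p(z). *)
Lemma cs_sum_sqr (p : A -> R) (cp : cseminorm p) a b :
  cstar a = a -> cstar b = b -> p a ^+ 2 <= p (a ** a + b ** b).
Proof.
move=> asa bsa; pose z := a + 'i *: b.
have zs : cstar z = a - 'i *: b.
  rewrite cstarD cstarZc asa bsa -scaleNr; congr (_ + _ *: _).
  by apply/eqP; rewrite eq_complex /= oppr0 !eqxx.
have zz : cstar z ** z = a ** a + b ** b.
  by rewrite zs csub_sqr cmulZl cmulZr scalerA -expr2 sqr_i scaleN1r opprK.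
rewrite -zz (csSE cp) ler_sqr ?nnegrE ?cs_ge0//.
have H : 2%:R%:C *: a = z + cstar z.
  by rewrite zs addrACA subrr addr0 rmorph_nat scaler_nat mulr2n.
have := csD cp z (cstar z); rewrite -H (csZ cp) nrm_real (cs_star cp) normr_nat.
by lra.
Qed.

Section Multiplicative.
Variable p : A -> R.
Hypothesis cp : cseminorm p.
Hypothesis pM : forall c a, cstar c = c -> p (c ** a) = p c * p a.

Let cs_sum_ge2 a b :
  cstar a = a -> cstar b = b -> p a = 1 -> p b = 1 -> 2 <= p (a ** a + b ** b).
Proof.
move=> asa bsa pa pb.
set u := a ** a; set v := b ** b.
pose y := a ** b + a ** b.
have absa : cstar (a ** b) = a ** b by rewrite cstarM asa bsa commA.
have usa : cstar u = u by rewrite cstarM asa.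
have vsa : cstar v = v by rewrite cstarM bsa.
have py : p y = 2.
  rewrite /y -mulr2n -scaler_nat -(rmorph_nat (real_complex R)) (csZ cp).
  by rewrite nrm_real normr_nat pM// pa pb !mulr1.
(* AM-GM: (a^2 + b^2)^2 = (2ab)^2 + (a^2 - b^2)^2 *)
have E : (u + v) ** (u + v) = y ** y + (u - v) ** (u - v).
  apply/eqP; rewrite -subr_eq -csub_sqr; apply/eqP.
  have -> : u + v - (u - v) = v + v by rewrite opprB addrC subrKA.
  have -> : u + v + (u - v) = u + u by rewrite addrACA subrr addr0.
  have -> : y ** y = a ** b ** (a ** b) *+ 4.
    by rewrite /y cmulDl !cmulDr -!mulr2n -mulrnA.
  rewrite cmulDl !cmulDr commA -!mulr2n -mulrnA; congr (_ *+ _).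
  by rewrite cmulACA.
have ysa : cstar y = y by rewrite cstarD absa.
have dsa : cstar (u - v) = u - v by rewrite cstarB usa vsa.
have := cs_sum_sqr cp ysa dsa.
rewrite -E (cs_sqr cp) ?cstarD ?usa ?vsa// py.
by rewrite ler_sqr ?nnegrE ?cs_ge0.
Qed.

Lemma cs_dichotomy a b : cstar a = a -> cstar b = b -> p a = 1 -> p b = 1 ->
  p (a - b) = 0 \/ p (a + b) = 0.
Proof.
move=> asa bsa pa pb.
pose sq n x : A := iter n (fun x => x ** x) x.
have sqsa n x : cstar x = x -> cstar (sq n x) = sq n x.
  by move=> xsa; elim: n => //= n IH; rewrite cstarM IH.
have psq n x : cstar x = x -> p x = 1 -> p (sq n x) = 1.
  by move=> xsa px; elim: n => //= n IH; rewrite (cs_sqr cp) ?sqsa// IH expr1n.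
pose D n := p (sq n a - sq n b).
have DS n : D n.+1 = D n * p (sq n a + sq n b).
  by rewrite -pM ?cstarB ?sqsa// csub_sqr.
have D2 n : D n <= 2.
  by apply: le_trans (csB cp _ _) _; rewrite !psq.
(* Doubling starts at index 1, where both entries are squares; at index 0 the factor is p(a + b),
   which may vanish. *)
have D1 n : D 1%N * 2 ^+ n <= D n.+1.
  elim: n => [|n IH]; first by rewrite expr0 mulr1.
  rewrite (DS n.+1) exprS mulrCA mulrC.
  apply: ler_pM; rewrite ?mulr_ge0 ?exprn_ge0 ?cs_ge0//.
  by apply: cs_sum_ge2; rewrite ?sqsa ?psq.
have D10 : D 1%N = 0.
  apply/eqP; rewrite eq_le (cs_ge0 cp) andbT leNgt; apply/negP => Dgt.
  have c0 : 0 <= 2 / D 1%N by rewrite divr_ge0// ltW.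
  have := archi_boundP c0; move: (Num.bound _) => n.
  rewrite ltr_pdivrMr//; apply/negP; rewrite -leNgt.
  apply: le_trans (D2 n.+1); apply: le_trans (D1 n); rewrite mulrC.
  rewrite ler_wpM2l ?(ltW Dgt)// -natrX ler_nat.
  by rewrite ltnW// ltn_expl.
have /eqP := DS 0%N; rewrite D10 eq_sym mulf_eq0 => /orP[]/eqP; by [left|right].
Qed.

End Multiplicative.

Record character (chi : A -> R[i]) : Prop := Character {
  chD : forall a b, chi (a + b) = chi a + chi b;
  chZ : forall k a, chi (k *: a) = k * chi a;
  chM : forall a b, chi (a ** b) = chi a * chi b;
  chS : forall a, chi (cstar a) = (chi a)^*%C;
  ch_le : forall a, nrm (chi a) <= nrm a }.

Lemma character0 : character (fun=> 0).
Proof.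
split=> *; rewrite ?addr0 ?mulr0 ?conjc0 ?nrm0 ?nrm_ge0//.
Qed.

Lemma cs_small (p : A -> R) (cp : cseminorm p) a b : p a = 0 -> p (a + b) = p b.
Proof.
move=> pa; apply/eqP; rewrite eq_le; apply/andP; split.
  by apply: le_trans (csD cp _ _) _; rewrite pa add0r.
by have := csB cp (a + b) a; rewrite pa addr0 addrC addKr.
Qed.

(** Modulo the null space of [p] every element is a multiple of [e], and [chi] reads off the
    coefficient. *)
Lemma multiplicative_character (p : A -> R) (cp : cseminorm p) e :
  (forall c a, cstar c = c -> p (c ** a) = p c * p a) ->
  cstar e = e -> p e = 1 ->
  exists2 chi, character chi & forall a, nrm (chi a) = p a.
Proof.
(* The dichotomy for e^2 and e makes [e] or [- e] idempotent modulo the null space. *)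
move=> pM; wlog pee : e / p (e ** e - e) = 0.
  move=> H esa pe.
  have eesa : cstar (e ** e) = e ** e by rewrite cstarM esa.
  have pee : p (e ** e) = 1 by rewrite (cs_sqr cp)// pe expr1n.
  have [h|h] := cs_dichotomy cp pM eesa esa pee pe; first exact: (H e).
  apply: (H (- e)); rewrite ?cstarN ?esa ?(csN cp)//.
  by rewrite cmulNl cmulNr !opprK.
move=> esa pe.
have pZe z : p (z *: e) = nrm z by rewrite (csZ cp) pe mulr1.
(* Once scaled to value 1, a self-adjoint element is [e] or [- e] modulo the null space, by the
   dichotomy. *)
have sa_line x : cstar x = x -> exists s : R, p (x - s%:C *: e) = 0.
  move=> xsa; have [px|px] := eqVneq (p x) 0.
    by exists 0; rewrite scale0r subr0.
  have px_gt0 : 0 < p x by rewrite lt_neqAle eq_sym px cs_ge0.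
  pose f := (p x)%:C *: e.
  have fsa : cstar f = f by rewrite cstarZc conjc_real esa.
  pose y := ((p x)^-1)%:C *: x.
  have ysa : cstar y = y by rewrite cstarZc conjc_real xsa.
  have py : p y = 1.
    by rewrite (csZ cp) nrm_real gtr0_norm ?invr_gt0// mulVf.
  have E : x = (p x)%:C *: y by rewrite scalerA -rmorphM/= divff// scale1r.
  have [h|h] := cs_dichotomy cp pM ysa esa py pe.
    by exists (p x); rewrite {1}E -scalerBr (csZ cp) h mulr0.
  exists (- p x); rewrite rmorphN/= scaleNr opprK {1}E -scalerDr (csZ cp) h.
  by rewrite mulr0.
have line x : exists z : R[i], p (x - z *: e) = 0.
  (* Twice the real and imaginary parts: x = (u + i v) / 2. *)
  pose u := x + cstar x; pose v := 'i *: (cstar x - x).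
  have usa : cstar u = u by rewrite cstarD cstarK addrC.
  have vsa : cstar v = v.
    rewrite cstarZc cstarB cstarK -opprB scalerN -scaleNr; congr (_ *: _).
    by apply/eqP; rewrite eq_complex /= oppr0 opprK !eqxx.
  have [s ps] := sa_line u usa; have [t pt] := sa_line v vsa.
  exists (2^-1 * (s%:C + 'i * t%:C)).
  have -> : x - (2^-1 * (s%:C + 'i * t%:C)) *: e
      = 2^-1 *: ((u - s%:C *: e) + 'i *: (v - t%:C *: e)).
    have {1}-> : x = 2^-1 *: (u + 'i *: v).
      rewrite scalerA -expr2 sqr_i scaleN1r opprB /u addrACA subrr addr0.
      have h : 2^-1 + 2^-1 = 1 :> R[i].
        by rewrite -[2^-1]mul1r -splitr.
      by rewrite scalerDr -scalerDl h scale1r.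
    rewrite -scalerA -scalerBr; congr (_ *: _).
    by rewrite scalerDl scalerBr ['i *: (_ *: e)]scalerA opprD addrACA.
  by rewrite (csZ cp) cs_small ?(csZ cp) ?pt ?mulr0.
have [chi chiP] := boolp.choice line.
have chiE x z : p (x - z *: e) = 0 -> chi x = z.
  move=> pz; apply/eqP; rewrite -subr_eq0; apply/eqP/nrm_eq0.
  rewrite -pZe scalerBl -(cs_small cp _ (chiP x)) addrA subrK.
  exact: pz.
exists chi; last first.
  by move=> a; rewrite -pZe -(cs_small cp _ (chiP a)) subrK.
split.
- move=> a b; apply: chiE; rewrite scalerDl opprD addrACA.
  by rewrite (cs_small cp).
- by move=> k a; apply: chiE; rewrite -scalerA -scalerBr (csZ cp) chiP mulr0.
- move=> a b; apply: chiE.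
  have -> : a ** b - (chi a * chi b) *: e =
      (a - chi a *: e) ** b + (chi a *: (e ** (b - chi b *: e)) +
      (chi a * chi b) *: (e ** e - e)).
    rewrite cmulBl cmulBr cmulZl cmulZr !scalerBr !scalerA.
    by rewrite addrA subrKA addrA subrK.
  have M0 x y : p x = 0 -> p (x ** y) = 0.
    move=> px; apply/eqP; rewrite eq_le (cs_ge0 cp) andbT.
    by apply: le_trans (csM cp _ _) _; rewrite px mul0r.
  rewrite (cs_small cp); last by rewrite M0.
  rewrite (cs_small cp); last by rewrite (csZ cp) commA M0 ?mulr0.
  by rewrite (csZ cp) pee mulr0.
- move=> a; apply: chiE.
  have -> : cstar a - (chi a)^*%C *: e = cstar (a - chi a *: e).
    by rewrite cstarB cstarZc esa.
  by rewrite (cs_star cp).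
- move=> a; rewrite -pZe -(cs_small cp _ (chiP a)) subrK.
  exact: cs_le cp _.
Qed.

(** A seminorm minimal among those of value 1 at a^* a / |a|^2 is the modulus of a character; the
    C*-identity turns that value into p(a) = |a|. *)
Theorem gelfand_norm a : exists2 chi, character chi & nrm (chi a) = nrm a.
Proof.
have [a0|a0] := eqVneq (nrm a) 0.
  by exists (fun=> 0); [exact: character0|rewrite a0 nrm0].
have a2 : nrm a ^+ 2 != 0 by rewrite sqrf_eq0.
have nV : nrm (((nrm a ^+ 2)^-1)%:C : R[i]) = (nrm a ^+ 2)^-1.
  by rewrite nrm_real ger0_norm// invr_ge0 sqr_ge0.
pose b := ((nrm a ^+ 2)^-1)%:C *: (cstar a ** a).
have bsa : cstar b = b by rewrite cstarZc conjc_real cstarM cstarK.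
have nb : nrm b = 1 by rewrite nrmZ nrm_star nV mulVf.
have [p [cp pb pmin]] := cseminorm_min nb.
have pM := min_csM cp bsa pb pmin.
have [chi cchi chiE] := multiplicative_character cp pM bsa pb.
exists chi => //; rewrite chiE; apply/eqP.
rewrite -(eqrXn2 (n := 2)) ?nrm_ge0 ?(cs_ge0 cp)//; apply/eqP.
move: pb; rewrite (csZ cp) (csSE cp) nV.
by move=> /(congr1 ( *%R (nrm a ^+ 2))); rewrite mulrA divff// mul1r mulr1.
Qed.

End Gelfand.

(** * Fibres of a Hilbert module *)

Section HilbertBasics.
Variables (R : realType) (A : cstarAlgType R) (E : hilbertModType A).
Implicit Types (x y u v w : E) (a m : A) (k : R[i]).

Lemma nrm_ip x : nrm x ^+ 2 = nrm (ip x x).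
Proof.
by apply: complexI; rewrite rmorphXn/= -!nrmE hnormE sqrtCK.
Qed.

(** The squared norm of [x] in the fibre at [chi]; [sqnP] shows that taking the real part loses
    nothing. *)
Definition sqn (chi : A -> R[i]) x : R := Re (chi (ip x x)).

Section Character.
Variable chi : A -> R[i].
Hypothesis cchi : character chi.

Lemma ch0 : chi 0 = 0.
Proof. by have := chZ cchi 0 0; rewrite scale0r mul0r. Qed.

Lemma chN a : chi (- a) = - chi a.
Proof. by rewrite -scaleN1r (chZ cchi) mulN1r. Qed.

Lemma chB a b : chi (a - b) = chi a - chi b.
Proof. by rewrite (chD cchi) chN. Qed.

Lemma ch_sum n (f : 'I_n -> A) :
  chi (\sum_(i < n) f i) = \sum_(i < n) chi (f i).
Proof.
by elim/big_ind2: _ => [|? ? ? ? <- <-|//]; rewrite ?ch0 ?(chD cchi).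
Qed.

Lemma ch_ipC x y : chi (ip y x) = (chi (ip x y))^*%C.
Proof. by rewrite -(chS cchi) ip_star. Qed.

Lemma ch_ipDl x y z : chi (ip (x + y) z) = chi (ip x z) + chi (ip y z).
Proof. by rewrite ipDl (chD cchi). Qed.

Lemma ch_ipDr x y z : chi (ip x (y + z)) = chi (ip x y) + chi (ip x z).
Proof. by rewrite ipDr (chD cchi). Qed.

Lemma ch_ipZl k x y : chi (ip (k *: x) y) = k^*%C * chi (ip x y).
Proof. by rewrite ipZl (chZ cchi). Qed.

Lemma ch_ipZr k x y : chi (ip x (k *: y)) = k * chi (ip x y).
Proof. by rewrite ipZr (chZ cchi). Qed.

Lemma ch_ipM x y a : chi (ip x (act y a)) = chi a * chi (ip x y).
Proof. by rewrite ip_actr (chM cchi) mulrC. Qed.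

Lemma sqnP x : chi (ip x x) = (sqn chi x)%:C /\ 0 <= sqn chi x.
Proof.
rewrite /sqn; have [b ->] := ip_ge0 x.
rewrite (chM cchi) (chS cchi) mulrC -sqr_normc nrmE -rmorphXn /=.
by rewrite exprn_ge0 ?nrm_ge0.
Qed.

Lemma sqnE x : chi (ip x x) = (sqn chi x)%:C.
Proof. by have [] := sqnP x. Qed.

Lemma sqn_ge0 x : 0 <= sqn chi x.
Proof. by have [] := sqnP x. Qed.

Lemma sqn_le x : sqn chi x <= nrm x ^+ 2.
Proof.
by rewrite nrm_ip; apply: le_trans (Re_le_nrm _) (ch_le cchi _).
Qed.

Lemma sqnZ k x : sqn chi (k *: x) = nrm k ^+ 2 * sqn chi x.
Proof.
rewrite /sqn ch_ipZl ch_ipZr sqnE nrm_sqr.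
by case: k => a b /=; ring.
Qed.

Lemma sqnDZ x y k : sqn chi (x + k *: y) =
  sqn chi x + 2 * Re (k * chi (ip x y)) + nrm k ^+ 2 * sqn chi y.
Proof.
rewrite -sqnZ /sqn ch_ipDl !ch_ipDr ch_ipZl ch_ipZr ch_ipZl ch_ipZr.
rewrite [chi (ip y x)]ch_ipC.
case: (chi (ip x y)) => a b; case: (chi (ip x x)) => c d.
case: (chi (ip y y)) => e f; case: k => g h /=.
by ring.
Qed.

Lemma ch_CauchySchwarz x y :
  nrm (chi (ip x y)) ^+ 2 <= sqn chi x * sqn chi y.
Proof.
set c := chi (ip x y).
have H (s : R) :
    0 <= sqn chi x - 2 * s * nrm c ^+ 2 + s ^+ 2 * nrm c ^+ 2 * sqn chi y.
  have := sqn_ge0 (x + (- s%:C * c^*%C) *: y).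
  rewrite sqnDZ -/c !nrm_sqr; case: (c) => a b /=.
  by congr (0 <= _); ring.
have := sqn_ge0 x; have := sqn_ge0 y.
set X := sqn chi x in H *; set Y := sqn chi y in H *.
set n := nrm c ^+ 2 in H *.
move=> Y0 X0; have n0 : 0 <= n by rewrite sqr_ge0.
have [Yz|Yn] := eqVneq Y 0.
  rewrite Yz mulr0 leNgt; apply/negP => ngt.
  (* This choice makes the expression, now affine in the parameter, equal to -1. *)
  have := H ((X + 1) / (2 * n)); rewrite Yz mulr0 addr0.
  have -> : 2 * ((X + 1) / (2 * n)) * n = X + 1 by field; rewrite gt_eqF.
  by lra.
have Ygt : 0 < Y by rewrite lt_neqAle eq_sym Yn.
have := H Y^-1.
have -> : X - 2 * Y^-1 * n + Y^-1 ^+ 2 * n * Y = (X * Y - n) / Y by field.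
by rewrite pmulr_lge0 ?invr_gt0// subr_ge0.
Qed.

Lemma sqn0_ip x y : sqn chi x = 0 -> chi (ip x y) = 0.
Proof.
move=> x0; apply: nrm_eq0; apply/eqP; rewrite -sqrf_eq0 eq_le sqr_ge0 andbT.
by apply: le_trans (ch_CauchySchwarz x y) _; rewrite x0 mul0r.
Qed.

(* [k *: v + act v m] is the action on [v] of [k + m] in the unitization. *)
Lemma ch_iter_ip k m n x v :
  chi (ip x (iter n (fun v => k *: v + act v m) v)) =
  (k + chi m) ^+ n * chi (ip x v).
Proof.
elim: n => [|n IH]; first by rewrite mul1r.
by rewrite iterS ch_ipDr ch_ipZr ch_ipM IH exprS; ring.
Qed.

Lemma ch_iter_ipl k m n x v :
  chi (ip (iter n (fun v => k *: v + act v m) v) x) =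
  ((k + chi m)^*%C) ^+ n * chi (ip v x).
Proof.
by rewrite ch_ipC ch_iter_ip rmorphM rmorphXn/= -(ch_ipC x v).
Qed.

Lemma sqn_iter k m n v :
  sqn chi (iter n (fun v => k *: v + act v m) v) =
  nrm ((k + chi m) ^+ n) ^+ 2 * sqn chi v.
Proof.
set v' := iter _ _ _; rewrite /sqn ch_iter_ip ch_ipC ch_iter_ip sqnE.
by rewrite nrm_sqr; case: ((k + chi m) ^+ n) => a b /=; ring.
Qed.

End Character.

Hypothesis commA : commutative (@cmul R A).

Lemma nrm_sqr_le x (r : R) :
  (forall chi, character chi -> sqn chi x <= r) -> nrm x ^+ 2 <= r.
Proof.
move=> H; have [chi cchi] := gelfand_norm commA (ip x x).
rewrite nrm_ip => <-; have [E0 x0] := sqnP cchi x.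
by rewrite E0 nrm_real ger0_norm// H.
Qed.

Lemma characters_separate (a : A) :
  (forall chi, character chi -> chi a = 0) -> a = 0.
Proof.
move=> H; have [chi cchi] := gelfand_norm commA a.
by rewrite H// nrm0 => /esym/nrm_eq0.
Qed.

End HilbertBasics.

(** * Real estimates for peaking powers (1 - z)^n *)

Section Peaks.
Variable R : realType.
Implicit Types z d e s t eps : R.

(** The induction rests on (1 - z)(1 + (n+1) z) <= 1 + n z. The resulting decay 1 / (1 + n z) is all
    that peaking requires. *)
Lemma bernoulli_inv z n : 0 <= z -> z <= 1 ->
  (1 - z) ^+ n * (1 + n%:R * z) <= 1.
Proof.
move=> z0 z1; elim: n => [|n IH]; first by rewrite mul0r addr0 mulr1.
apply: le_trans IH; rewrite exprS [_ * _ ^+ n]mulrC -mulrA ler_wpM2l//.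
  by rewrite exprn_ge0// subr_ge0.
rewrite -natr1; have : 0 <= n%:R * z ^+ 2 :> R by rewrite mulr_ge0 ?sqr_ge0.
have := sqr_ge0 z; lra.
Qed.

Lemma bernoulli_inv_sqr z n : 0 <= z -> z <= 1 ->
  ((1 - z) ^+ n) ^+ 2 * (1 + 2 * n%:R * z) <= 1.
Proof.
move=> z0 z1; rewrite -exprM mulnC.
by have := bernoulli_inv (2 * n) z0 z1; rewrite natrM.
Qed.

(** Where [s] is far from 1 or [d] far from 0, [z] is large and the square of (1 - z)^n is at most 1
    / (1 + 2 n z). With n >= t^2 the errors stay bounded independently of [t]. *)
Lemma peak_bounds (dl s d t : R) n :
  let z := dl * ((s - 1) ^+ 2 + d ^+ 2) in
  0 < dl -> z <= 1 -> t ^+ 2 <= n%:R ->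
  t ^+ 2 * (((1 - z) ^+ n) ^+ 2 * s) <= t ^+ 2 + dl^-1 /\
  t * ((1 - z) ^+ n * d) <= 1 + dl^-1.
Proof.
move=> z dl0 z1 tn.
have z0 : 0 <= z by rewrite mulr_ge0 ?addr_ge0 ?sqr_ge0 ?ltW.
have := bernoulli_inv_sqr n z0 z1.
set Q := (1 - z) ^+ n; set N : R := n%:R in tn *.
have Q0 : 0 <= Q ^+ 2 by rewrite sqr_ge0.
have t20 : 0 <= t ^+ 2 by rewrite sqr_ge0.
have N0 : 0 <= N by rewrite ler0n.
have Q1 : Q ^+ 2 <= 1 by rewrite -exprM exprn_ile1 ?subr_ge0// gerBl.
have [P PE] : exists P, P = Q ^+ 2 by exists (Q ^+ 2).
have [T TE] : exists T, T = t ^+ 2 by exists (t ^+ 2).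
rewrite -PE in Q0 Q1 *; rewrite -TE in t20 tn *.
move: Q0 Q1 t20 tn => P0 P1 T0 TN H.
have dV : dl * dl^-1 = 1 by rewrite divff ?gt_eqF.
split.
  rewrite -(ler_pM2l dl0) mulrDr dV.
  set e := s - 1; have -> : s = 1 + e by rewrite /e addrC subrK.
  have ez : dl * e ^+ 2 <= z by rewrite ler_wpM2l ?(ltW dl0)// lerDl sqr_ge0.
  have K1 : P * (1 + 2 * N * (dl * e ^+ 2)) <= 1.
    apply: le_trans H; rewrite ler_wpM2l// lerD2l ler_wpM2l// mulr_ge0//.
  have K2 : (T * dl) * (P * (1 + 2 * N * (dl * e ^+ 2))) <= T * dl.
    by rewrite ler_piMr// mulr_ge0// (ltW dl0).
  have K3 : P * (2 * (T * dl * e) ^+ 2) <= P * (2 * N * T * (dl * e) ^+ 2).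
    rewrite ler_wpM2l//.
    have : 0 <= (N - T) * (T * (dl * e) ^+ 2).
      by apply: mulr_ge0; [rewrite subr_ge0|rewrite mulr_ge0 ?sqr_ge0].
    lra.
  (* For x = T dl e, completing the square gives x - 2 x^2 <= 1/8. *)
  have K4 : P * (T * dl * e - 2 * (T * dl * e) ^+ 2) <= 1.
    have [h|h] := leP (T * dl * e - 2 * (T * dl * e) ^+ 2) 0.
      by apply: le_trans ler01; rewrite mulr_ge0_le0.
    apply: le_trans (ler_piMl (ltW h) P1) _.
    have := sqr_ge0 (T * dl * e - 4^-1).
    lra.
  lra.
set X := t * (Q * d).
have X2 : dl * X ^+ 2 <= 1.
  have -> : dl * X ^+ 2 = T * P * (dl * d ^+ 2).
    by rewrite /X TE PE; ring.
  have dz : dl * d ^+ 2 <= z by rewrite ler_wpM2l ?(ltW dl0)// lerDr sqr_ge0.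
  have K1 : T * P * (dl * d ^+ 2) <= N * P * z.
    apply: ler_pM => //; [exact: mulr_ge0| |exact: ler_wpM2r].
    by rewrite mulr_ge0 ?sqr_ge0 ?(ltW dl0).
  have : 0 <= N * P * z by rewrite mulr_ge0 ?(mulr_ge0 N0).
  lra.
have X3 : X ^+ 2 <= dl^-1 by rewrite -(ler_pM2l dl0) dV.
have := sqr_ge0 (X - 1); have := sqr_ge0 X; nra.
Qed.

(** If s - s0 exceeds [eps], then z >= dl eps (s - s0), and the decay in [n] brings the damped
    excess below [eps]; otherwise damping by a factor at most 1 suffices. *)
Lemma peak_limit (dl s s0 eps : R) n :
  let z := dl * (s - s0) ^+ 2 in
  0 < dl -> 0 < eps -> 0 <= s0 -> z <= 1 -> 1 <= 2 * n%:R * dl * eps ^+ 2 ->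
  ((1 - z) ^+ n) ^+ 2 * s <= s0 + eps.
Proof.
move=> z dl0 eps0 s00 z1 Hn.
have z0 : 0 <= z by rewrite mulr_ge0 ?sqr_ge0 ?ltW.
have := bernoulli_inv_sqr n z0 z1.
set Q := (1 - z) ^+ n; set N : R := n%:R in Hn *.
have Q0 : 0 <= Q ^+ 2 by rewrite sqr_ge0.
have N0 : 0 <= N by rewrite ler0n.
have Q1 : Q ^+ 2 <= 1 by rewrite -exprM exprn_ile1 ?subr_ge0// gerBl.
move: (Q ^+ 2) Q0 Q1 => P P0 P1 H.
have -> : s = s0 + (s - s0) by rewrite addrC subrK.
move: (s - s0) @z z0 z1 {Q} H => e z z0 z1 H.
have Ps0 : P * s0 <= s0 by rewrite ler_piMl.
rewrite mulrDr lerD//.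
have [h|h] := leP e eps.
  have [e0|e0] := leP e 0.
    by apply: le_trans (ltW eps0); rewrite mulr_ge0_le0.
  by rewrite -[eps]mul1r ler_pM// ltW.
rewrite -(ler_pM2r (_ : 0 < 2 * N * dl * eps)).
  have K : P * (2 * N * dl) * (e * eps) <= P * (2 * N * dl) * (e * e).
    rewrite ler_wpM2l ?mulr_ge0 ?(ltW dl0)// ler_wpM2l ?(ltW h)// ltW//.
    exact: lt_trans h.
  rewrite /z in H; lra.
have : 0 < 2 * N * dl * eps * eps.
  by apply: lt_le_trans ltr01 _; rewrite -mulrA -expr2.
by rewrite pmulr_lgt0.
Qed.

End Peaks.

(** * Fibrewise action of an isometry *)

Section Isometry.
Variables (R : realType) (A B : cstarAlgType R).
Hypotheses (commA : commutative (@cmul R A)) (commB : commutative (@cmul R B)).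
Variables (E : hilbertModType A) (F : hilbertModType B).
Variables (T : {linear E -> F}) (T' : {linear F -> E}).
Hypotheses (TK : cancel T T') (T'K : cancel T' T).
Hypothesis T_isom : forall x, nrm (T x) = nrm x.
Implicit Types (x y : E) (u v w : F) (a : A) (b : B).

(** At each [psi], T' y + x a and T' y + psi(a) x have the same fibre norm, so a common bound for
    all |y + psi(a) T x| also bounds |y + T(x a)|. For large y peaking along [w], the terms linear
    in the size of y decide. *)
Lemma fibre_bound (chi : B -> R[i]) x a w (r : R) :
  character chi -> sqn chi w = 1 -> 0 <= r ->
  (forall psi : A -> R[i], character psi ->
     Re (psi a * chi (ip w (T x))) <= r) ->
  Re (chi (ip w (T (act x a)))) <= r.
Proof.
move=> cchi w1 r0 H.
set u := T x in H *; set rho := Re (chi _).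
pose h := ip w w; pose k := ip w u; pose kap := chi k.
(* [K] dominates (psi h - 1)^2 + |psi k - kap|^2 at every [psi], which keeps z <= 1. *)
pose K := (nrm h + 1) ^+ 2 + (nrm k + nrm kap) ^+ 2 + 1.
have K0 : 0 < K by rewrite ltr_wpDl ?addr_ge0 ?sqr_ge0.
pose dl := K^-1; have dl0 : 0 < dl by rewrite invr_gt0.
(* [k0 + m] takes at psi the value 1 - dl ((psi h - 1)^2 + |psi k - kap|^2), so
   [W n] is [w] times a function peaking where h and k are as at chi. The proof
   compares the norms of [t W n + T (x a)] and [t W n + mu u] with [n >= t^2],
   as t goes to infinity. *)
pose m : B := (- dl)%:C *: (h ** h - 2 *: h
  + (cstar k ** k - kap *: cstar k - (kap^*)%C *: k)).
pose k0 : R[i] := (1 - dl * (1 + nrm kap ^+ 2))%:C.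
pose W n : F := iter n (fun v => k0 *: v + act v m) w.
pose s psi := sqn psi w.
pose d (psi : B -> R[i]) := nrm (psi k - kap).
pose z psi := dl * ((s psi - 1) ^+ 2 + d psi ^+ 2).
have qE psi : character psi -> k0 + psi m = (1 - z psi)%:C.
  move=> cpsi; rewrite /m (chZ cpsi) !(chD cpsi) !chN// !(chZ cpsi) !(chM cpsi).
  rewrite (chS cpsi) /h sqnE// -/(s psi) /k0 /z /d !nrm_sqr -/k -/kap.
  case: (psi k) => e f; case: (kap) => g l /=.
  by apply/eqP; rewrite eq_complex /=; apply/andP; split; apply/eqP; ring.
have s_ge0 psi : character psi -> 0 <= s psi by move=> c; rewrite /s sqn_ge0.
have z1 psi : character psi -> z psi <= 1.
  move=> cpsi; rewrite /z mulrC ler_pdivrMr// mul1r.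
  apply: (@le_trans _ _ ((nrm h + 1) ^+ 2 + (nrm k + nrm kap) ^+ 2)).
  2: by rewrite lerDl.
  have hs : s psi <= nrm h by rewrite /s /h -nrm_ip; exact: sqn_le.
  have hd : d psi <= nrm k + nrm kap.
    by apply: le_trans (nrmD _ _) _; rewrite nrmN lerD2r (ch_le cpsi).
  rewrite lerD//; last by rewrite ler_sqr ?nnegrE ?addr_ge0 ?nrm_ge0.
  have := s_ge0 _ cpsi; move: (nrm_ge0 h) hs; nra.
pose lam := nrm a.
(* The errors independent of [t]: from the squared norm of y, from the cross term and from the term
   quadratic in [mu]. *)
pose C := dl^-1 + 2 * lam * (1 + dl^-1) + lam ^+ 2 * nrm u ^+ 2.
have main (t : R) : 0 < t -> t ^+ 2 + 2 * t * rho <= t ^+ 2 + 2 * t * r + C.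
  move=> t0; pose n := Num.bound (t ^+ 2).
  have tn : t ^+ 2 <= n%:R by apply/ltW/archi_boundP; rewrite sqr_ge0.
  pose y := t%:C *: W n.
  have sqnW psi : character psi ->
      sqn psi y = t ^+ 2 * (((1 - z psi) ^+ n) ^+ 2 * s psi).
    move=> cpsi; rewrite sqnZ// sqn_iter// qE// -rmorphXn/= !nrm_real.
    by rewrite !real_normK ?num_real.
  have ipW psi v : character psi ->
      psi (ip y v) = (t * (1 - z psi) ^+ n)%:C * psi (ip w v).
    move=> cpsi; rewrite ch_ipZl// conjc_real ch_iter_ipl// qE// conjc_real.
    by rewrite mulrA -rmorphXn -rmorphM.
  have bound (mu : R[i]) : nrm mu <= lam -> Re (mu * kap) <= r ->
      nrm (y + mu *: u) ^+ 2 <= t ^+ 2 + 2 * t * r + C.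
    move=> mu_le mur; apply: (nrm_sqr_le commB) => psi cpsi.
    rewrite sqnDZ// sqnW// ipW// -/k.
    have [] := peak_bounds dl0 (z1 _ cpsi) tn.
    rewrite -/(z psi); set Q := (1 - z psi) ^+ n => P1 P2.
    have Q0 : 0 <= Q by rewrite exprn_ge0// subr_ge0 z1.
    have Q1 : Q <= 1.
      rewrite exprn_ile1 ?subr_ge0 ?z1// gerBl mulr_ge0 ?(ltW dl0)//.
      by rewrite addr_ge0 ?sqr_ge0.
    have lam0 : 0 <= lam by exact: nrm_ge0.
    have d0 : 0 <= d psi by exact: nrm_ge0.
    have h1 : Re (mu * psi k) <= r + lam * d psi.
      have -> : mu * psi k = mu * kap + mu * (psi k - kap) by ring.
      rewrite raddfD/= lerD//; apply: le_trans (Re_le_nrm _) _.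
      by rewrite nrmM ler_wpM2r.
    have h2 : Re (mu * ((t * Q)%:C * psi k)) = t * Q * Re (mu * psi k).
      by case: (psi k) => e f; case: (mu) => g l /=; ring.
    have h3 : t * Q * Re (mu * psi k) <= t * r + lam * (1 + dl^-1).
      apply: (@le_trans _ _ (t * Q * (r + lam * d psi))).
        by rewrite ler_wpM2l// mulr_ge0// ltW.
      have : t * (Q * r) <= t * r by rewrite ler_wpM2l ?(ltW t0)// ler_piMl.
      have := ler_wpM2l lam0 P2; lra.
    have h4 : nrm mu ^+ 2 * sqn psi u <= lam ^+ 2 * nrm u ^+ 2.
      apply: ler_pM; rewrite ?sqr_ge0 ?sqn_ge0 ?sqn_le//.
      by rewrite ler_sqr ?nnegrE ?nrm_ge0.
    rewrite h2 /C; lra.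
  have z0 : z chi = 0.
    by rewrite /z /d /s -/kap subrr w1 subrr nrm0 !expr0n addr0 mulr0.
  have E1 : sqn chi (y + 1 *: T (act x a)) <= t ^+ 2 + 2 * t * r + C.
    apply: le_trans (sqn_le cchi _) _; rewrite scale1r.
    have -> : y + T (act x a) = T (T' y + act x a) by rewrite raddfD/= T'K.
    rewrite T_isom; apply: (nrm_sqr_le commA) => psi cpsi.
    have -> : sqn psi (T' y + act x a) = sqn psi (T' y + psi a *: x).
      have := sqnDZ cpsi (T' y) (act x a) 1; rewrite scale1r => ->.
      rewrite sqnDZ// ch_ipM// mul1r; congr (_ + _).
      rewrite /sqn ip_actl (chM cpsi) ch_ipM// (chS cpsi) (sqnE cpsi).
      rewrite !nrm_sqr; case: (psi a) => e f /=; ring.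
    apply: le_trans (sqn_le cpsi _) _.
    rewrite -T_isom raddfD/= T'K linearZ/= -/u.
    by apply: bound; [exact: ch_le|exact: H].
  move: E1; rewrite sqnDZ// mul1r sqnW// ipW// z0 subr0 !expr1n /s w1 !mulr1.
  rewrite (_ : Re (t%:C * _) = t * rho); last first.
    by rewrite /rho; case: (chi _) => e f /=; ring.
  have := sqn_ge0 cchi (T (act x a)).
  rewrite nrm_sqr /= !expr0n expr1n addr0 mul1r; lra.
rewrite leNgt; apply/negP => rgt.
have rr : 0 < rho - r by rewrite subr_gt0.
have C0 : 0 <= C.
  have lam0 : 0 <= lam by exact: nrm_ge0.
  have V0 : 0 <= dl^-1 by rewrite invr_ge0 ltW.
  have := mulr_ge0 lam0 V0; have := mulr_ge0 (sqr_ge0 lam) (sqr_ge0 (nrm u)).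
  rewrite /C; lra.
(* At this [t] the gap 2 t (rho - r) is C + 1, more than [main] allows. *)
have tpos : 0 < (C + 1) / (2 * (rho - r)).
  by rewrite divr_gt0 ?mulr_gt0// ltr_wpDl.
have := main _ tpos.
set t := _ / _ in tpos *.
have : 2 * t * (rho - r) = C + 1 by rewrite /t; field; rewrite gt_eqF.
lra.
Qed.

End Isometry.

(** The rotation by the conjugate of [k] over its modulus turns [k] into its modulus. *)
Lemma nrm_le_Re (R : realType) (k : R[i]) (r : R) :
  (forall l : R[i], nrm l = 1 -> Re (l * k) <= r) -> nrm k <= r.
Proof.
have [-> H|k0 H] := eqVneq k 0.
  have := H 1; rewrite mulr0 nrm0 => -> //.
  by rewrite -(rmorph1 (real_complex R)) nrm_real normr1.
have n0 : nrm k != 0 by apply: contra_neq k0; exact: nrm_eq0.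
have := H ((nrm k)^-1%:C * k^*%C).
have -> : (nrm k)^-1%:C * k^*%C * k = (nrm k)%:C.
  rewrite -mulrA [k^*%C * k]mulrC -sqr_normc nrmE -rmorphXn -rmorphM/=.
  by rewrite expr2 mulKf.
apply; rewrite nrmM nrm_real ger0_norm ?invr_ge0 ?nrm_ge0//.
by rewrite /nrm normcJ mulVf.
Qed.

Lemma fibre_normalize (R : realType) (A : cstarAlgType R) (E : hilbertModType A)
    (chi : A -> R[i]) (x : E) : character chi -> sqn chi x != 0 ->
  exists2 c : R, c != 0 & sqn chi (c%:C *: x) = 1.
Proof.
move=> cchi x0; have xgt : 0 < sqn chi x by rewrite lt_neqAle eq_sym x0 sqn_ge0.
exists (Num.sqrt (sqn chi x))^-1; first by rewrite invr_neq0// sqrtr_eq0 -ltNge.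
rewrite sqnZ// nrm_real real_normK ?num_real// exprVn sqr_sqrtr ?ltW//.
by rewrite mulVf.
Qed.

(** * The character of [A] induced by a nonzero fibre of [F] *)

Section FibreCharacter.
Variables (R : realType) (A B : cstarAlgType R).
Hypotheses (commA : commutative (@cmul R A)) (commB : commutative (@cmul R B)).
Variables (E : hilbertModType A) (F : hilbertModType B).
Variables (T : {linear E -> F}) (T' : {linear F -> E}).
Hypotheses (TK : cancel T T') (T'K : cancel T' T).
Hypothesis T_isom : forall x, nrm (T x) = nrm x.
Implicit Types (x y : E) (u v w : F) (a : A) (b : B).

Section FixCharacter.
Variable chi : B -> R[i].
Hypothesis cchi : character chi.

Lemma fibre_nrm_bound x a w (r : R) : sqn chi w = 1 -> 0 <= r ->
  (forall psi : A -> R[i], character psi ->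
     nrm (psi a * chi (ip w (T x))) <= r) ->
  nrm (chi (ip w (T (act x a)))) <= r.
Proof.
move=> w1 r0 H; apply: nrm_le_Re => l l1.
have nl : nrm l^*%C = 1 by rewrite /nrm normcJ.
have := @fibre_bound _ _ _ commA commB _ _ _ _ T'K T_isom chi x a
  (l^*%C *: w) r cchi.
rewrite !ch_ipZl// conjcK; apply=> //; first by rewrite sqnZ// nl expr1n mul1r.
move=> psi cpsi; apply: le_trans (Re_le_nrm _) _.
by rewrite mulrCA nrmM l1 mul1r H.
Qed.

(** This is the bound with r = 0, after scaling [w] to a unit vector of the fibre. *)
Lemma fibre_orthogonal x a w :
  chi (ip w (T x)) = 0 -> chi (ip w (T (act x a))) = 0.
Proof.
move=> wx; have [w0|w0] := eqVneq (sqn chi w) 0; first exact: sqn0_ip.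
have [c c0 cw] := fibre_normalize cchi w0.
have : nrm (chi (ip (c%:C *: w) (T (act x a)))) <= 0.
  apply: fibre_nrm_bound => // psi cpsi.
  by rewrite ch_ipZl// wx !mulr0 nrm0.
rewrite ch_ipZl// => H.
have /eqP : nrm ((c%:C)^*%C * chi (ip w (T (act x a)))) = 0.
  by apply/eqP; rewrite eq_le H nrm_ge0.
rewrite conjc_real nrmM nrm_real mulf_eq0 normr_eq0 (negbTE c0)/=.
by move/eqP/nrm_eq0.
Qed.

Variable v : F.
Hypothesis v1 : sqn chi v = 1.

Let psi a := chi (ip v (T (act (T' v) a))).

(** On the fibre, [S] maps every vector into its own line by [fibre_orthogonal]; such an operator is
    a scalar, and the unit vector [v] reads it off. *)
Lemma fibre_scalar a w x : chi (ip w (T (act x a))) = psi a * chi (ip w (T x)).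
Proof.
pose S u := T (act (T' u) a).
have SD u u' : S (u + u') = S u + S u' by rewrite /S raddfD/= actDl raddfD.
have SZ k u : S (k *: u) = k *: S u by rewrite /S linearZ/= actZl linearZ.
have S0 w' u : chi (ip w' u) = 0 -> chi (ip w' (S u)) = 0.
  by move=> H; apply: fibre_orthogonal; rewrite T'K.
have vv : chi (ip v v) = 1 by rewrite sqnE// v1.
suff H w' u : chi (ip w' (S u)) = psi a * chi (ip w' u).
  by have := H w (T x); rewrite /S TK.
have Hv u' : chi (ip v (S u')) = psi a * chi (ip v u').
  have := S0 v (u' + (- chi (ip v u')) *: v).
  rewrite SD SZ !ch_ipDr// !ch_ipZr// vv mulr1 subrr => /(_ erefl).
  by move=> /eqP; rewrite mulNr subr_eq0 => /eqP ->; rewrite mulrC.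
(* A multiple of [v] is added to [w1] to make it orthogonal to [u']. *)
have Hn w1 u' : chi (ip v u') != 0 ->
    chi (ip w1 (S u')) = psi a * chi (ip w1 u').
  move=> n0; pose l := - (chi (ip w1 u') / chi (ip v u')).
  have := S0 (w1 + (l^*%C) *: v) u'.
  rewrite !ch_ipDl// !ch_ipZl// conjcK Hv /l mulNr divfK// subrr => /(_ erefl).
  move=> /eqP; rewrite mulNr subr_eq0 => /eqP ->.
  by rewrite mulrCA divfK// mulrC.
have [u0|u0] := eqVneq (chi (ip v u)) 0; last exact: Hn.
(* Adding [v] gives a vector with component 1 along [v]. *)
have := Hn w' (u + v); rewrite ch_ipDr// u0 add0r vv oner_eq0 => /(_ isT).
rewrite SD !ch_ipDr// (Hn w' v) ?vv ?oner_eq0// mulrDr.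
by move/addIr.
Qed.

(** Multiplicativity is [fibre_scalar] at T'(v) a. Real values on self-adjoint elements yield
    compatibility with the star, and [fibre_nrm_bound] yields contractivity. *)
Lemma fibre_character : character psi.
Proof.
have vv : chi (ip v v) = 1 by rewrite sqnE// v1.
have psiD a a' : psi (a + a') = psi a + psi a'.
  by rewrite /psi actDr raddfD/= ch_ipDr.
have psiZ k a : psi (k *: a) = k * psi a.
  by rewrite /psi actZr linearZ/= ch_ipZr.
have sa a : cstar a = a -> Im (psi a) = 0.
  move=> asa.
  (* [v] is rotated so that [phi a * chi <v, v>] is imaginary for all phi. *)
  have H (l : R[i]) : nrm l = 1 -> Re l = 0 -> Re (l * psi a) <= 0.
    move=> l1 l0; have nl : nrm l^*%C = 1 by rewrite /nrm normcJ.
    have := @fibre_bound _ _ _ commA commB _ _ _ _ T'K T_isom chi (T' v) a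
      (l^*%C *: v) 0 cchi.
    rewrite !ch_ipZl// conjcK; apply=> //.
      by rewrite sqnZ// nl expr1n mul1r.
    move=> phi cphi; rewrite T'K vv mulr1.
    have := chS cphi a; rewrite asa.
    case: (phi a) => c d [] dd; case: (l) l0 => e f /= ->.
    have -> : d = 0 by lra.
    by rewrite mulr0 mul0r subr0.
  have := H 'i (nrm_i _) erefl.
  have := H (- 'i); rewrite nrmN => /(_ (nrm_i _)).
  by case: (psi a) => c d /=; rewrite oppr0 => /(_ erefl); lra.
split=> //.
- by move=> a a'; rewrite {1}/psi actA fibre_scalar mulrC.
- move=> a.
  have h1 : Im (psi (a + cstar a)) = 0.
    by apply: sa; rewrite cstarD cstarK addrC.
  have h2 : Im (psi ('i *: (a - cstar a))) = 0.
    apply: sa; rewrite cstarZc cstarB cstarK -opprB scalerN -scaleNr.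
    by congr (_ *: _); apply/eqP; rewrite eq_complex /= oppr0 opprK !eqxx.
  move: h1 h2; rewrite psiZ !psiD -scaleN1r psiZ mulN1r.
  case: (psi a) => c d; case: (psi _) => e f /= h1 h2.
  by apply/eqP; rewrite eq_complex/=; apply/andP; split; apply/eqP; lra.
- move=> a; apply: fibre_nrm_bound; rewrite ?nrm_ge0// => phi cphi.
  by rewrite T'K vv mulr1 ch_le.
Qed.

End FixCharacter.

(** A damping factor equal to 1 at [psi] leaves T x unchanged in the fibre at [chi], while it brings
    the squared norm of [x] down to at most s0 + eps. *)
Lemma sqn_isom_le chi (psi : A -> R[i]) x :
  character chi -> character psi ->
  (forall a w y, chi (ip w (T (act y a))) = psi a * chi (ip w (T y))) ->
  sqn chi (T x) <= sqn psi x.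
Proof.
move=> cchi cpsi link; apply/ler_addgt0Pr => eps eps0.
set s0 := sqn psi x; pose h := ip x x.
have s00 : 0 <= s0 by exact: sqn_ge0.
pose K := (nrm h + s0) ^+ 2 + 1.
have K0 : 0 < K by rewrite ltr_wpDl ?sqr_ge0.
pose dl := K^-1; have dl0 : 0 < dl by rewrite invr_gt0.
(* [k0 + m] takes the value 1 - dl (phi h - s0)^2 at phi; it is 1 at psi, so
   [T W] and [T x] agree at chi. *)
pose m : A := (- dl)%:C *: (h ** h - (2 * s0)%:C *: h).
pose k0 : R[i] := (1 - dl * s0 ^+ 2)%:C.
pose n := Num.bound (2 * dl * eps ^+ 2)^-1.
pose W := iter n (fun y => k0 *: y + act y m) x.
have qE phi : character phi -> k0 + phi m = (1 - dl * (sqn phi x - s0) ^+ 2)%:C.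
  move=> cphi; rewrite /m (chZ cphi) (chD cphi) chN// (chZ cphi) (chM cphi).
  rewrite /h sqnE// /k0.
  by apply/eqP; rewrite eq_complex /=; apply/andP; split; apply/eqP; ring.
have k0m : k0 + psi m = 1 by rewrite qE// subrr expr0n mulr0 subr0.
have TW w : chi (ip w (T W)) = chi (ip w (T x)).
  rewrite /W; elim: (n) => // j IH.
  rewrite iterS raddfD/= linearZ/= ch_ipDr// ch_ipZr// link -mulrDl.
  by rewrite k0m mul1r.
have -> : sqn chi (T x) = sqn chi (T W).
  by rewrite /sqn TW ch_ipC// -TW -ch_ipC//.
apply: le_trans (sqn_le cchi _) _; rewrite T_isom.
apply: (nrm_sqr_le commA) => phi cphi.
rewrite sqn_iter// qE// -rmorphXn/= nrm_real real_normK ?num_real//.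
have c0 : 0 < 2 * dl * eps ^+ 2 by rewrite !mulr_gt0// exprn_gt0.
apply: peak_limit => //.
- rewrite mulrC ler_pdivrMr// mul1r.
  have hs : sqn phi x <= nrm h by rewrite /h -nrm_ip; exact: sqn_le.
  by have := sqn_ge0 cphi x; rewrite /K; nra.
- have : (2 * dl * eps ^+ 2)^-1 <= n%:R.
    by apply/ltW/archi_boundP; rewrite invr_ge0 ltW.
  by rewrite -[_^-1]mul1r ler_pdivrMr//; lra.
Qed.

End FibreCharacter.

(** * Related characters *)

Lemma linear_of (K : pzRingType) (U V : lmodType K) (f : U -> V) :
  linear f -> exists g : {linear U -> V}, g =1 f.
Proof.
move=> lf.
pose g : {linear U -> V} := HB.pack f (GRing.isLinear.Build K U V *:%R f lf).
by exists g.
Qed.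

(** A relation rather than a map between the spectra: it needs no choice of partner and is symmetric
    under exchanging [T] with its inverse. *)
Definition related (R : realType) (A B : cstarAlgType R) (E : hilbertModType A)
    (F : hilbertModType B) (T : E -> F) (chi : B -> R[i]) (psi : A -> R[i]) :=
  forall x y : E, chi (ip (T x) (T y)) = psi (ip x y).

Section Spectra.
Variables (R : realType) (A B : cstarAlgType R).
Hypotheses (commA : commutative (@cmul R A)) (commB : commutative (@cmul R B)).
Variables (E : hilbertModType A) (F : hilbertModType B).
Variables (T : {linear E -> F}) (T' : {linear F -> E}).
Hypotheses (TK : cancel T T') (T'K : cancel T' T).
Hypothesis T_isom : forall x, nrm (T x) = nrm x.
Implicit Types (x y : E) (u v w : F) (a : A) (b : B).

Let T'_isom u : nrm (T' u) = nrm u.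
Proof. by rewrite -T_isom T'K. Qed.

(** Going from [chi] to [psi] by [T] and on to [sig] by the inverse only increases fibre norms. Once
    sig = chi, all these inequalities are equalities. *)
Lemma related_exists (chi : B -> R[i]) : character chi ->
  exists2 psi : A -> R[i], character psi & related T chi psi.
Proof.
move=> cchi.
have [[v0 v00]|none] := pselect (exists v, sqn chi v != 0); last first.
  exists (fun=> 0); first exact: character0.
  move=> x y; apply: sqn0_ip => //; apply/eqP; apply: contra_notT none => h.
  by exists (T x).
have [c c0 v1] := fibre_normalize cchi v00.
set v := _ *: v0 in v1.
have [psi cpsi link] : exists2 psi : A -> R[i], character psi &
    forall a w x, chi (ip w (T (act x a))) = psi a * chi (ip w (T x)).
  exists (fun a => chi (ip v (T (act (T' v) a)))).
    exact: (fibre_character commA commB TK T'K).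
  by move=> a w x; apply: (fibre_scalar commA commB TK T'K).
have leT x : sqn chi (T x) <= sqn psi x by apply: sqn_isom_le.
have w0 : sqn psi (T' v) != 0.
  by rewrite gt_eqF// (lt_le_trans ltr01)// -v1 -{1}(T'K v) leT.
have [d d0 w1] := fibre_normalize cpsi w0.
set w := _ *: T' v in w1.
have [sig csig link'] : exists2 sig : B -> R[i], character sig &
    forall b x u, psi (ip x (T' (act u b))) = sig b * psi (ip x (T' u)).
  exists (fun b => psi (ip w (T' (act (T w) b)))).
    exact: (fibre_character commB commA T'K TK).
  by move=> b x u; apply: (fibre_scalar commB commA T'K TK).
have leT' u : sqn psi (T' u) <= sqn sig u by apply: sqn_isom_le.
have le_sig u : sqn chi u <= sqn sig u.
  by rewrite -{1}(T'K u); apply: le_trans (leT _) (leT' _).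
have E1 b : sig b = chi b.
  (* The element b - sig(b) of the unitization sends [v] to a vector that vanishes in the fibre at
     [sig], hence in the one at [chi]. *)
  have := le_sig (iter 1 (fun u => (- sig b) *: u + act u b) v).
  rewrite !sqn_iter// !expr1 addNr nrm0 expr0n mul0r v1 mulr1 => H.
  have : nrm (- sig b + chi b) ^+ 2 = 0 by apply/eqP; rewrite eq_le H sqr_ge0.
  move/eqP; rewrite sqrf_eq0 => /eqP/nrm_eq0/eqP.
  by rewrite addrC subr_eq0 => /eqP.
have sqn_eq x : sqn chi (T x) = sqn psi x.
  apply/eqP; rewrite eq_le leT /=; have := leT' (T x).
  by rewrite TK /sqn E1.
exists psi => // x y.
have H k : Re (k * chi (ip (T x) (T y))) = Re (k * psi (ip x y)).
  have := sqn_eq (x + k *: y); rewrite raddfD/= linearZ/= !sqnDZ//.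
  by rewrite !sqn_eq; lra.
move: (H 1) (H 'i); rewrite !mul1r.
case: (chi _) => p q; case: (psi _) => s t /= -> h.
by apply/eqP; rewrite eq_complex/= eqxx; apply/eqP; lra.
Qed.

(** The graph of the future isomorphism, tested on related pairs of characters. *)
Definition matches a b := forall chi psi, character chi -> character psi ->
  related T chi psi -> chi b = psi a.

Lemma matches_sum n (x y : 'I_n -> E) :
  matches (\sum_(i < n) ip (x i) (y i)) (\sum_(i < n) ip (T (x i)) (T (y i))).
Proof.
move=> chi psi cchi cpsi rel; rewrite !ch_sum//.
by apply: eq_bigr => i _; exact: rel.
Qed.

Lemma matchesB a a' b b' : matches a b -> matches a' b' ->
  matches (a - a') (b - b').
Proof.
by move=> H H' chi psi cchi cpsi rel; rewrite !chB// (H _ psi)// (H' _ psi).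
Qed.

(** The norm of [b] is attained at some [chi], and its partner [psi] is contractive. *)
Lemma matches_nrm a b : matches a b -> nrm b <= nrm a.
Proof.
move=> H; have [chi cchi <-] := gelfand_norm commB b.
have [psi cpsi rel] := related_exists cchi.
by rewrite (H _ psi)// ch_le.
Qed.

(** Sums of inner products match their images and are dense. By [matches_nrm] the images of an
    approximating sequence are Cauchy, and contractivity of characters carries matching to the
    limit. *)
Lemma matches_total : full_module E -> forall a, exists b, matches a b.
Proof.
move=> fullE a.
have approx (n : nat) : exists ab : A * B,
    matches ab.1 ab.2 /\ nrm (a - ab.1) < n.+1%:R^-1.
  have : closure [set a : A | exists (n : nat) (x y : 'I_n -> E),
      a = \sum_(i < n) ip (x i) (y i)] a by rewrite fullE.
  have e0 : 0 < n.+1%:R^-1 :> R[i] by rewrite invr_gt0 ltr0n.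
  move=> /(_ _ (nbhsx_ballx a _ e0))[_ [[m [x [y ->]]]]].
  rewrite -ball_normE /= => H.
  exists (\sum_(i < m) ip (x i) (y i), \sum_(i < m) ip (T (x i)) (T (y i))).
  split; first exact: matches_sum.
  by rewrite -ltcR -nrmE fmorphV rmorph_nat.
have [f fP] := boolp.choice approx.
pose bs n := (f n).2.
have bs_close n m : nrm (bs n - bs m) < n.+1%:R^-1 + m.+1%:R^-1.
  have [Mn Dn] := fP n; have [Mm Dm] := fP m.
  apply: le_lt_trans (matches_nrm (matchesB Mn Mm)) _.
  have -> : (f n).1 - (f m).1 = (a - (f m).1) - (a - (f n).1).
    by rewrite opprB [RHS]addrC subrKA.
  apply: le_lt_trans (nrmD _ _) _; rewrite nrmN addrC.
  exact: ltrD.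
have small (e : R) : 0 < e -> exists N, forall n, (N <= n)%N -> n.+1%:R^-1 < e.
  move=> e0; exists (Num.bound e^-1) => n Nn.
  rewrite invf_plt ?posrE ?ltr0n//.
  apply: lt_le_trans (archi_boundP _) _; first by rewrite invr_ge0 ltW.
  by rewrite ler_nat (leq_trans Nn).
have cv : cvg (bs @ \oo).
  apply/cauchy_cvgP/cauchy_exP => e e0.
  have eR : e = (Re e)%:C by rewrite RRe_real// gtr0_real.
  have e20 : 0 < Re e / 2 by rewrite divr_gt0// -ltcR -eR.
  have [N HN] := small _ e20.
  exists (bs N); exists N => // n /= Nn.
  rewrite -ball_normE /= nrmE eR ltcR; apply: lt_trans (bs_close _ _) _.
  by rewrite [ltRHS]splitr ltrD ?HN.
have /cvgrPdist_lt lim_bs := cv.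
exists (lim (bs @ \oo)) => chi psi cchi cpsi rel.
apply/eqP; rewrite -subr_eq0; apply/eqP/nrm_eq0/eqP.
rewrite eq_le nrm_ge0 andbT.
apply/ler_addgt0Pr => e e0; rewrite add0r.
have e20 : 0 < e / 2 by rewrite divr_gt0.
have [N HN] := small _ e20.
have [M _ HM] := lim_bs (e / 2)%:C (etrans (ltcR _ _) e20).
pose n := maxn N M; have [Hn Dn] := fP n.
have -> : chi (lim (bs @ \oo)) - psi a =
    chi (lim (bs @ \oo) - bs n) - psi (a - (f n).1).
  by rewrite !chB// /bs (Hn chi psi)// opprB subrKA.
apply: le_trans (nrmD _ _) _; rewrite nrmN [leRHS]splitr lerD//.
  apply: le_trans (ch_le cchi _) _; apply: ltW.
  by rewrite -ltcR -nrmE; apply: HM; rewrite /= leq_maxr.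
apply: le_trans (ch_le cpsi _) _; apply: ltW.
by apply: lt_trans Dn _; apply: HN; rewrite leq_maxl.
Qed.

End Spectra.

(** * Construction of the star-isomorphism *)

Lemma relatedV (R : realType) (A B : cstarAlgType R) (E : hilbertModType A)
    (F : hilbertModType B) (T : E -> F) (T' : F -> E) (chi : B -> R[i])
    (psi : A -> R[i]) :
  cancel T' T -> related T chi psi -> related T' psi chi.
Proof. by move=> T'K rel u v; rewrite -rel !T'K. Qed.

Theorem corollary2 (R : realType) (A B : cstarAlgType R)
    (commA : commutative (@cmul R A)) (commB : commutative (@cmul R B))
    (E : hilbertModType A) (F : hilbertModType B)
    (fullE : full_module E) (fullF : full_module F)
    (T : {linear E -> F})
    (T_surj : forall y : F, exists x : E, T x = y)
    (T_isom : forall x : E, `|T x| = `|x|) :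
  exists phi : {linear A -> B},
    [/\ star_isomorphism phi,
        forall x y : E, ip (T x) (T y) = phi (ip x y)
      & forall (x : E) (a : A), T (act x a) = act (T x) (phi a)].
Proof.
have [S SK] := boolp.choice T_surj.
have T_inj : injective T.
  move=> x y /eqP; rewrite -subr_eq0 -raddfB -normr_eq0 T_isom normr_eq0.
  by rewrite subr_eq0 => /eqP.
have S_linear : linear S.
  by move=> k u v; apply: T_inj; rewrite raddfD/= linearZ/= !SK.
have [T' T'E] := linear_of S_linear.
have T'K : cancel T' T by move=> u; rewrite T'E SK.
have TK : cancel T T' by move=> x; apply: T_inj; rewrite T'K.
have isom x : nrm (T x) = nrm x by rewrite /nrm T_isom.
have isom' u : nrm (T' u) = nrm u by rewrite -isom T'K.
have [f fP] := boolp.choice (matches_total commA commB TK T'K isom fullE).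
have [g gP] := boolp.choice (matches_total commB commA T'K TK isom' fullF).
(* Every character of [A] has a partner on [B], so related pairs already separate points. *)
have eqA a a' : (forall chi psi, character chi -> character psi ->
    related T chi psi -> psi a = psi a') -> a = a'.
  move=> H; apply/eqP; rewrite -subr_eq0; apply/eqP.
  apply: (characters_separate commA) => psi cpsi.
  have [chi cchi rel] := related_exists commB commA T'K TK isom' cpsi.
  by rewrite chB// (H chi)// ?subrr//; exact: relatedV rel.
have eqB b b' : (forall chi psi, character chi -> character psi ->
    related T chi psi -> chi b = chi b') -> b = b'.
  move=> H; apply/eqP; rewrite -subr_eq0; apply/eqP.
  apply: (characters_separate commB) => chi cchi.
  have [psi cpsi rel] := related_exists commA commB TK T'K isom cchi.
  by rewrite chB// (H _ psi)// ?subrr.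
have f_linear : linear f.
  move=> k a a'; apply: eqB => chi psi cchi cpsi rel.
  rewrite (fP _ chi psi)// !(chD cchi, chD cpsi) (chZ cchi) (chZ cpsi).
  by rewrite !(fP _ chi psi).
have gK b chi psi : character chi -> character psi -> related T chi psi ->
    psi (g b) = chi b.
  by move=> cchi cpsi rel; apply: gP => //; exact: relatedV rel.
have [phi phiE] := linear_of f_linear.
have phiP a chi psi : character chi -> character psi -> related T chi psi ->
    chi (phi a) = psi a by rewrite phiE; exact: fP.
exists phi; split.
- split.
  + exists g => [a|b].
      apply: eqA => chi psi cchi cpsi rel.
      by rewrite (gK _ chi)// (phiP _ _ psi).
    by apply: eqB => chi psi cchi cpsi rel; rewrite (phiP _ _ psi)// (gK _ chi).
  + move=> a a'; apply: eqB => chi psi cchi cpsi rel.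
    by rewrite (chM cchi) !(phiP _ _ psi)// (chM cpsi).
  + move=> a; apply: eqB => chi psi cchi cpsi rel.
    by rewrite (chS cchi) !(phiP _ _ psi)// (chS cpsi).
- move=> x y; apply: eqB => chi psi cchi cpsi rel.
  by rewrite (phiP _ _ psi)// rel.
move=> x a; apply/eqP; rewrite -subr_eq0; apply/eqP; apply: ip_eq0.
set z := T _ - _; apply: eqB => chi psi cchi cpsi rel.
(* Writing w = T(T' w) moves both terms to [A], where each becomes psi(a) psi<T' w, x>. *)
suff H w : chi (ip w z) = 0 by rewrite H ch0.
rewrite /z ch_ipDr// -scaleN1r ch_ipZr// mulN1r -(T'K w) rel !ch_ipM//.
by rewrite rel (phiP _ _ psi)// subrr.
Qed.
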